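(* For an $H$-MBQC with symmetry group $H$, the input group may always be chosen to be $Q=H/N$, where $N=\{n\in H: na=a\ \ \forall a\in E\}$. That is, the group $Q=H/N$ with its induced action $[h]a:=ha$ on $E$ satisfies the two requirements on an input group: (i) $qa\in E_{\mathcal{O}}$ for all $a\in E_{\mathcal{O}}$ and $q\in Q$; (ii) $q(a\oplus b)=qa\oplus qb$ for all $q\in Q$ and all $a,b\in E$ with $[T_a,T_b]=0$ and $a\in E_{\mathcal{O}}$ or $b\in E_{\mathcal{O}}$.
   Context: Observables. Fix a finite-dimensional Hilbert space. $\mathcal{O}$ is a set of observables (Hermitian operators with eigenvalues $\pm1$ only) with $A\in\mathcal{O}\Leftrightarrow -A\in\mathcal{O}$. A resolution of an observable $X$ in $\mathcal{O}$ is a product $X=A_1(A_2(\cdots(A_{K-1}A_K)))$, $K\ge 1$, $A_i\in\mathcal{O}$, such that with $B_i:=\prod_{l=i+1}^K A_l$ (in this order) $[A_i,B_i]=0$ for $i=1,\dots,K-1$. $\mathcal{I}$ is the set of all observables having a resolution in $\mathcal{O}$; it is closed under $A\mapsto -A$. $E$ is the set of classes $\{A,-A\}$, $A\in\mathcal{I}$; for each $a\in E$ a representative $T_a\in\mathcal{I}$ is fixed, so $\mathcal{I}=\{\pm T_a: a\in E\}$. $E_{\mathcal{O}}:=\{a\in E: T_a\in\mathcal{O}\}$. For $a\in E_{\mathcal{O}}$, $b\in E$ with $[T_a,T_b]=0$, $a\oplus b\in E$ is defined by $T_{a\oplus b}=\pm T_aT_b$ (when instead $b\in E_{\mathcal{O}}$,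 $a\oplus b$ likewise denotes the class of $\pm T_aT_b$); in particular (ii) asserts that the right-hand side is defined. Symmetry group. $H$ is a group acting on the set $\mathcal{I}$ such that $h(-A)=-h(A)$ for all $A\in\mathcal{I}$, $h\in H$; hence $H$ acts on $E$ via $h(T_a)=\pm T_{ha}$. It satisfies, for all $h\in H$: (1) $h(A)\in\mathcal{O}$ for all $A\in\mathcal{O}$; (2) $h(A)h(B)=h(AB)$ for all $A,B\in\mathcal{I}$ with $[A,B]=0$ and $AB\in\mathcal{I}$. (3) A symmetry group of an $H$-MBQC also preserves the set $\mathcal{R}_o$ of signed output observables: $\mathcal{R}_o=\{(-1)^{o(q)}\prod_{a\in\mathcal{E}_{\rm e}}T_{qa}\}$, $q$ ranging over the inputs, where $o$ is the output function with values in $\mathbb{Z}_2$ and $\mathcal{E}_{\rm e}\subset E_{\mathcal{O}}$ is the ordered set of edges measured for the trivial input. $N$ is a normal subgroup of $H$, being the kernel of the action on $E$. *)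

(* Defs.v *)
From HB Require Import structures.
From mathcomp Require Import all_boot all_order all_algebra.
From mathcomp Require Import all_classical reals.
From mathcomp Require Export complex.

Set Implicit Arguments.
Unset Strict Implicit.
Unset Printing Implicit Defensive.

Import Order.TTheory GRing.Theory Num.Theory.
Local Open Scope classical_set_scope.
Local Open Scope ring_scope.
Local Open Scope complex_scope.
Local Open Scope quotient_scope.

Record normal_subgroup (H : groupType) (N : set H) : Prop := {
  normal1 : N 1%g;
  normalM : forall x y, N x -> N y -> N (x * y)%g;
  normalV : forall x, N x -> N (x^-1)%g;
  normalJ : forall x y, N x -> N (x ^ y)%g
}.

(* The group H / N, for H possibly infinite. *)
Section QuotientGroup.
Variables (H : groupType) (N : set H) (nN : normal_subgroup N).

Definition coset_rel : rel H := fun x y => (x^-1 * y)%g \in N.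

Lemma coset_rel_equiv : equiv_class_of coset_rel.
Proof.
have [N1 NM NV NJ] := nN; rewrite /coset_rel; split.
- by move=> x; rewrite mulVg inE.
- have sym x y : (x^-1 * y)%g \in N -> (y^-1 * x)%g \in N.
    by rewrite !inE => /NV; rewrite invgM invgK.
  by move=> x y; apply/idP/idP; apply: sym.
- move=> y x z; rewrite !inE => xy yz.
  by have := NM _ _ xy yz; rewrite -mulgA mulVKg.
Qed.

Definition coset_equiv : equiv_rel H := EquivRelPack coset_rel_equiv.

Definition quotient_group : Type := {eq_quot coset_equiv}.

HB.instance Definition _ := Choice.on quotient_group.
HB.instance Definition _ := EqQuotient.on quotient_group.

(* The canonical projection H -> H / N. *)
Definition quotient_pi (x : H) : quotient_group := \pi x.

Lemma quotient_piP (x y : H) :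
  reflect (quotient_pi x = quotient_pi y) (coset_rel x y).
Proof. by apply: (iffP idP) => [xy|/eqmodP//]; exact/eqmodP. Qed.

Lemma quotient_ind (P : quotient_group -> Prop) :
  (forall x, P (quotient_pi x)) -> forall u, P u.
Proof. by move=> Ppi u; rewrite -[u]reprK; apply: Ppi. Qed.

Lemma repr_coset (x : H) : N (x^-1 * repr (quotient_pi x))%g.
Proof.
have /quotient_piP : quotient_pi x = quotient_pi (repr (quotient_pi x)).
  by rewrite /quotient_pi reprK.
by rewrite /coset_rel inE.
Qed.

Let Qone : quotient_group := quotient_pi 1%g.
Let Qmul (u v : quotient_group) : quotient_group :=
  quotient_pi (repr u * repr v)%g.
Let Qinv (u : quotient_group) : quotient_group := quotient_pi (repr u)^-1%g.

Let QmulE x y : Qmul (quotient_pi x) (quotient_pi y) = quotient_pi (x * y)%g.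
Proof.
apply/esym/quotient_piP; rewrite /coset_rel inE.
have [_ NM _ NJ] := nN.
have := NM _ _ (NJ _ y (repr_coset x)) (repr_coset y).
by rewrite /conjg invgM !mulgA mulgK.
Qed.

Let QinvE x : Qinv (quotient_pi x) = quotient_pi x^-1%g.
Proof.
apply/quotient_piP; rewrite /coset_rel inE invgK.
have [_ _ _ NJ] := nN.
have := NJ _ x^-1%g (repr_coset x).
by rewrite /conjg invgK !mulgA mulgV mul1g.
Qed.

Let QmulA : associative Qmul.
Proof.
elim/quotient_ind=> x; elim/quotient_ind=> y; elim/quotient_ind=> z.
by rewrite !QmulE mulgA.
Qed.

Let Qmul1 : left_id Qone Qmul.
Proof. by elim/quotient_ind=> x; rewrite QmulE mul1g. Qed.

Let Qmulr1 : right_id Qone Qmul.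
Proof. by elim/quotient_ind=> x; rewrite QmulE mulg1. Qed.

Let QmulV : left_inverse Qone Qinv Qmul.
Proof. by elim/quotient_ind=> x; rewrite QinvE QmulE mulVg. Qed.

Let QmulrV : right_inverse Qone Qinv Qmul.
Proof. by elim/quotient_ind=> x; rewrite QinvE QmulE mulgV. Qed.

HB.instance Definition _ :=
  isGroup.Build quotient_group QmulA Qmul1 Qmulr1 QmulV QmulrV.

Lemma quotient_piM (x y : H) :
  quotient_pi (x * y)%g = (quotient_pi x * quotient_pi y)%g.
Proof. by rewrite -QmulE. Qed.

Lemma quotient_pi1 : quotient_pi 1%g = 1%g.
Proof. by []. Qed.

End QuotientGroup.

Definition group_action (G : groupType) (X : Type) (act : G -> X -> X) : Prop :=
  (forall x, act 1%g x = x) /\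
  (forall g h x, act (g * h)%g x = act g (act h x)).

Section Observables.
Variables (R : realType) (n : nat).
Local Notation op := 'M[R[i]]_n.

Definition observable (A : op) : Prop :=
  A \is hermsymmx /\ forall x, eigenvalue A x -> x = 1 \/ x = -1.

Definition observable_set (O : set op) : Prop :=
  (forall A, O A -> observable A) /\ (forall A, O A <-> O (- A)).

Definition prodmx (s : seq op) : op := \big[mulmx/1%:M]_(A <- s) A.

(* With s = [:: A_1; ...; A_K], A_i is nth 0 s i.-1 and B_i is the product
   of drop i s. *)
Definition resolution (O : set op) (s : seq op) (X : op) : Prop :=
  [/\ (0 < size s)%N,
      {in s, forall A, O A},
      X = prodmx s &
      forall i, (i.+1 < size s)%N ->
        comm_mx (nth 0 s i) (prodmx (drop i.+1 s))].

Definition resolvable (O : set op) : set op :=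
  [set X | observable X /\ exists s, resolution O s X].

Definition pmclass (A : op) : set op := [set A; - A].

Definition edges (O : set op) : set (set op) :=
  [set pmclass A | A in resolvable O].

Lemma observable_sqr (A : op) : observable A -> A *m A = 1%:M.
Proof.
move=> [/hermitian_normalmx /orthomx_spectralP eA eigA].
set P := spectralmx A in eA; set d := spectral_diag A in eA.
have uP : P \in unitmx := spectral_unit A.
have PA : P *m A = diag_mx d *m P by rewrite {1}eA !mulmxA mulmxV // mul1mx.
have d1 i : d 0 i * d 0 i = 1.
  suff /eigA[->|->] : eigenvalue A (d 0 i) by rewrite ?mulrNN mulr1.
  apply/eigenvalueP; exists (row i P).
    by rewrite -row_mul PA row_mul row_diag_mx -scalemxAl -rowE.
  have : row_free P by rewrite row_free_unit.
  apply: contraTneq => r0; rewrite row_free_unit unitmxE (expand_det_row _ i).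
  rewrite big1 ?unitr0 // => j _.
  by have /rowP/(_ j) := r0; rewrite !mxE => ->; rewrite mul0r.
have dd : diag_mx d *m diag_mx d = 1%:M.
  rewrite mulmx_diag -diag_const_mx; congr diag_mx.
  by apply/rowP => i; rewrite !mxE.
rewrite -[A *m A]mul1mx -(mulVmx uP) -mulmxA (mulmxA P) PA -mulmxA PA.
by rewrite (mulmxA (diag_mx d)) dd mul1mx.
Qed.

Lemma observable_mul (A B : op) :
  observable A -> observable B -> comm_mx A B -> observable (A *m B).
Proof.
move=> oA oB AB; split.
  have [/is_hermitianmxP hA _] := oA; have [/is_hermitianmxP hB _] := oB.
  rewrite expr0 scale1r in hA; rewrite expr0 scale1r in hB.
  apply/is_hermitianmxP; rewrite expr0 scale1r trmx_mul map_mxM.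
  by rewrite -hA -hB AB.
move=> x /eigenvalueP[v vAB v0].
have sqAB : A *m B *m (A *m B) = 1%:M.
  rewrite {2}AB -mulmxA (mulmxA B) observable_sqr // mul1mx.
  exact: observable_sqr.
have : v *m (A *m B *m (A *m B)) = (x * x) *: v.
  by rewrite [LHS]mulmxA vAB -scalemxAl vAB scalerA.
rewrite sqAB mulmx1 -{1}[v]scale1r => /eqP.
rewrite -subr_eq0 -scalerBl scaler_eq0 (negPf v0) orbF subr_eq0 eq_sym -expr2.
by rewrite sqrf_eq1 => /orP[]/eqP ->; [left|right].
Qed.

Lemma resolvable_mul (O : set op) (A B : op) :
  O A -> resolvable O A -> resolvable O B -> comm_mx A B ->
  resolvable O (A *m B).
Proof.
move=> OA [oA _] [oB [s [s0 sO Bs sc]]] AB; split.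
  exact: observable_mul.
exists (A :: s); split => //.
- by move=> C; rewrite inE => /orP[/eqP->//|/sO].
- by rewrite /prodmx big_cons -/(prodmx s) -Bs.
- by move=> [_|i /sc//]; rewrite /= drop0 -Bs.
Qed.

Definition edge (O : set op) (A : resolvable O) : edges O :=
  SigSub (mem_set (imageP pmclass (set_mem (valP A)))).

Section Edges.
Variables (O : set op) (T : edges O -> resolvable O).

Definition observable_edges : set (edges O) := [set a | O (val (T a))].

Definition oplus_defined (a b : edges O) : Prop :=
  comm_mx (val (T a)) (val (T b)) /\
  (observable_edges a \/ observable_edges b).

Lemma oplus_subproof (a b : edges O) (ab : oplus_defined a b) :
  pmclass (val (T a) *m val (T b)) \in edges O.
Proof.
have Ia := set_mem (valP (T a)); have Ib := set_mem (valP (T b)).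
apply/mem_set/imageP; have [cab [Oa|Ob]] := ab; first exact: resolvable_mul.
by rewrite cab; apply: resolvable_mul.
Qed.

Definition oplus (a b : edges O) (ab : oplus_defined a b) : edges O :=
  SigSub (oplus_subproof ab).

(* The existential qab says that the right-hand side is defined. *)
Record input_group_action (Q : groupType) (qact : Q -> edges O -> edges O) :
    Prop := {
  input_action : group_action qact;
  input_edges : forall q a, observable_edges a -> observable_edges (qact q a);
  input_oplus : forall q a b (ab : oplus_defined a b),
    exists qab : oplus_defined (qact q a) (qact q b),
      qact q (oplus ab) = oplus qab
}.

Definition output_observables (Q : groupType) (qact : Q -> edges O -> edges O)
    (Ee : seq (edges O)) (o : Q -> 'Z_2) : set op :=
  [set (-1) ^+ (o q : nat) *: prodmx [seq val (T (qact q a)) | a <- Ee]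
    | q in [set: Q]].

End Edges.

Section Symmetry.
Variables (O : set op) (T : edges O -> resolvable O).
Variables (H : groupType) (hact : H -> resolvable O -> resolvable O).

Record observable_symmetry : Prop := {
  symmetry_action : group_action hact;
  symmetryN : forall h (A A' : resolvable O),
    val A' = - val A -> val (hact h A') = - val (hact h A);
  symmetry_obs : forall h (A : resolvable O), O (val A) -> O (val (hact h A));
  symmetryM : forall h (A B AB : resolvable O),
    comm_mx (val A) (val B) -> val AB = val A *m val B ->
    val (hact h A) *m val (hact h B) = val (hact h AB)
}.

(* H only acts on resolvable O, so the elements of S outside it, if any, are
   left unconstrained. *)
Definition preserves (S : set op) : Prop :=
  forall h (A : resolvable O), S (val A) -> S (val (hact h A)).

(* The class h a of h(T_a), that is, h(T_a) = +/- T_(h a). *)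
Definition edge_act (h : H) (a : edges O) : edges O := edge (hact h (T a)).

Definition edge_kernel : set H := [set m | forall a, edge_act m a = a].

End Symmetry.
End Observables.

(* Main.v *)
(** Since [h] commutes with [A |-> -A], the class of [h A] depends only on the
    class of [A].  Hence the action of [H] on observables descends to the
    classes, and then to [H / N].  The compatibility with [oplus] comes from
    [h A h B = h (A B)]; applying it also to [B A = A B] shows that [h A] and
    [h B] commute. *)
Require Import Defs.
From mathcomp Require Import all_boot all_order all_algebra.
From mathcomp Require Import all_classical reals complex.

Local Open Scope classical_set_scope.
Local Open Scope ring_scope.
Local Open Scope complex_scope.

Import GRing.Theory.

Section ClassesUpToSign.
Context {R : realType} {n : nat}.
Implicit Types A B C D : 'M[R[i]]_n.

Lemma pmclassN A : pmclass (- A) = pmclass A.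
Proof. by rewrite /pmclass opprK setUC. Qed.

Lemma pmclass_eqP A B : pmclass A = pmclass B <-> A = B \/ A = - B.
Proof.
split=> [AB|[->//|->]]; last exact: pmclassN.
by have : pmclass A A by [left]; rewrite AB => -[]; [left|right].
Qed.

Lemma pmclass_mul A B C D :
  pmclass A = pmclass C -> pmclass B = pmclass D ->
  pmclass (A *m B) = pmclass (C *m D).
Proof.
by move=> /pmclass_eqP[]-> /pmclass_eqP[]->;
  rewrite ?mulNmx ?mulmxN ?opprK ?pmclassN.
Qed.

(** Signs enter both sides of the commutation equation equally, so commuting depends only on the
    classes. This carries it over to the representatives fixed by [T]. *)
Lemma comm_mx_pmclass A B C D :
  pmclass A = pmclass C -> pmclass B = pmclass D ->
  comm_mx C D -> comm_mx A B.
Proof.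
by rewrite /comm_mx => /pmclass_eqP[]-> /pmclass_eqP[]-> CD;
  rewrite ?mulNmx ?mulmxN CD.
Qed.

Lemma observable_set_pmclass (O : set 'M[R[i]]_n) A B :
  observable_set O -> pmclass A = pmclass B -> O B -> O A.
Proof. by move=> [_ ON] /pmclass_eqP[]-> //; rewrite -ON. Qed.

Context {O : set 'M[R[i]]_n}.

Lemma edge_eqP (A B : resolvable O) :
  edge A = edge B <-> pmclass (val A) = pmclass (val B).
Proof. by split=> [/(congr1 val)|AB]; last exact: val_inj. Qed.

End ClassesUpToSign.

Section InducedAction.
Context {R : realType} {n : nat} {O : set 'M[R[i]]_n}.
Hypothesis hO : observable_set O.
Context {T : edges O -> resolvable O}.
Hypothesis hT : forall a, edge (T a) = a.
Context {H : groupType} {hact : H -> resolvable O -> resolvable O}.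
Hypothesis hsym : observable_symmetry hact.

Local Notation act := (edge_act T hact).
Local Notation N := (edge_kernel T hact).

Lemma edge_hact h (A B : resolvable O) :
  edge A = edge B -> edge (hact h A) = edge (hact h B).
Proof.
move=> /edge_eqP/pmclass_eqP[/val_inj->//|AB]; apply/edge_eqP.
by rewrite (symmetryN hsym _ AB) pmclassN.
Qed.

(** Although [edge_act] is computed through [T], any other representative of the class gives the
    same result. *)
Lemma edge_act_edge h (A : resolvable O) : act h (edge A) = edge (hact h A).
Proof. exact: edge_hact. Qed.

Lemma edge_action : group_action act.
Proof.
have [h1 hM] := symmetry_action hsym.
split=> [a|g h a]; first by rewrite /edge_act h1 hT.
by rewrite {1}/edge_act hM -!edge_act_edge hT.
Qed.

Lemma edge_kernel_normal : normal_subgroup N.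
Proof.
have [a1 aM] := edge_action.
have NV x : N x -> N x^-1%g.
  (* Write [a] as [x a], which [x^-1] carries back to [a]. *)
  by move=> Nx a; rewrite -{1}(Nx a) -aM mulVg a1.
split=> // [x y Nx Ny a|x y Nx a]; first by rewrite aM Ny Nx.
(* In [y^-1 * (x * y)] the factor [x] fixes the class [y a]. *)
by rewrite /conjg !aM Nx -aM mulVg a1.
Qed.

Lemma pmclass_edge_act h a :
  pmclass (val (T (act h a))) = pmclass (val (hact h (T a))).
Proof. by apply/edge_eqP; rewrite hT. Qed.

Lemma edge_act_observable h a :
  observable_edges T a -> observable_edges T (act h a).
Proof.
move=> /(symmetry_obs hsym h).
exact: (observable_set_pmclass _ _ _ hO (pmclass_edge_act h a)).
Qed.

(** While [oplus] yields only a class, [H] acts on observables, so the product itself is needed as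
    an element of [resolvable O]. *)
Lemma resolvable_oplus a b : oplus_defined T a b ->
  resolvable O (val (T a) *m val (T b)).
Proof.
have Ia := set_mem (valP (T a)); have Ib := set_mem (valP (T b)).
move=> [cab [Oa|Ob]]; first exact: resolvable_mul.
(* A resolution is extended on the left, so the factor lying in [O] is first commuted to the
   front. *)
by rewrite cab; apply: resolvable_mul.
Qed.

Lemma edge_act_oplus h a b (ab : oplus_defined T a b) :
  exists hab : oplus_defined T (act h a) (act h b),
    act h (oplus ab) = oplus hab.
Proof.
pose AB : resolvable O := SigSub (mem_set (resolvable_oplus a b ab)).
have [cab Oab] := ab.
have hAB : val (hact h (T a)) *m val (hact h (T b)) = val (hact h AB).
  exact: (symmetryM hsym).
have hBA : val (hact h (T b)) *m val (hact h (T a)) = val (hact h AB).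
  by apply: (symmetryM hsym) => //; exact/esym.
have hab : oplus_defined T (act h a) (act h b).
  split.
    apply: comm_mx_pmclass (pmclass_edge_act h a) (pmclass_edge_act h b) _.
    by rewrite /comm_mx hAB.
  by case: Oab => ?; [left|right]; exact: edge_act_observable.
exists hab; have -> : oplus ab = edge AB by exact: val_inj.
rewrite edge_act_edge; apply: val_inj; rewrite /= -hAB.
by apply/esym/pmclass_mul; exact: pmclass_edge_act.
Qed.

(** Each coset acts as a single element of [H], so the properties proved for one [h] apply to it
    directly. *)
Definition quotient_edge_act (nN : normal_subgroup N)
  (u : quotient_group nN) : edges O -> edges O := act (repr u).

Lemma quotient_edge_actE (nN : normal_subgroup N) h a :
  quotient_edge_act nN (quotient_pi nN h) a = act h a.
Proof.
have [_ aM] := edge_action.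
(* The representative is [h] times an element of the kernel, and the latter fixes [a]. *)
by rewrite -[in RHS](repr_coset nN h a) -aM mulVKg.
Qed.

Lemma quotient_input_group_action (nN : normal_subgroup N) :
  input_group_action T (quotient_edge_act nN).
Proof.
have [a1 aM] := edge_action.
split.
- split=> [a|]; first by rewrite -quotient_pi1 quotient_edge_actE.
  (* The representative of a product need not be the product of the representatives, so the law is
     checked on projections of elements of [H]. *)
  elim/quotient_ind=> g; elim/quotient_ind=> h a.
  by rewrite -quotient_piM !quotient_edge_actE.
- by move=> u a; exact: edge_act_observable.
- by move=> u a b ab; exact: edge_act_oplus.
Qed.

End InducedAction.

Theorem theorem3 (R : realType) (n : nat)
    (O : set 'M[R[i]]_n) (hO : observable_set O)
    (T : edges O -> resolvable O) (hT : forall a, edge (T a) = a)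
    (H : groupType) (hact : H -> resolvable O -> resolvable O)
    (hsym : observable_symmetry hact)
    (Q0 : groupType) (qact0 : Q0 -> edges O -> edges O)
    (hQ0 : input_group_action T qact0)
    (Ee : seq (edges O)) (hEe_uniq : uniq Ee)
    (hEe : {in Ee, forall a, observable_edges T a}) (o : Q0 -> 'Z_2)
    (hRo : preserves hact (output_observables T qact0 Ee o)) :
  exists (nN : normal_subgroup (edge_kernel T hact))
         (qact : quotient_group nN -> edges O -> edges O),
    (forall h a, qact (quotient_pi nN h) a = edge_act T hact h a) /\
    input_group_action T qact.
Proof.
have nN := edge_kernel_normal hT hsym.
exists nN, (quotient_edge_act nN); split.
  exact: quotient_edge_actE.
exact: quotient_input_group_action.
Qed.
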